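(* Let $(\mathfrak g,[\,,]_{\mathfrak g},\phi)$ be a finite-dimensional endo Lie algebra over a field $K$. Suppose that there is an endo Lie algebra $(\mathfrak g^*,[\,,]_{\mathfrak g^*},\psi^* )$ on the linear dual $\mathfrak g^*$ of $\mathfrak g$, where $\psi^*$ is the transpose of a linear map $\psi:\mathfrak g\to\mathfrak g$. Let $\delta:\mathfrak g\to\mathfrak g\otimes\mathfrak g$ denote the linear dual of the multiplication $[\,,]_{\mathfrak g^*}:\mathfrak g^*\otimes\mathfrak g^*\to\mathfrak g^*$. Then the following statements are equivalent: (a) the quadruple $((\mathfrak g,\phi),(\mathfrak g^*,\psi^* ),\mathrm{ad}_{\mathfrak g}^*,\mathrm{ad}_{\mathfrak g^*}^* )$ is a matched pair of endo Lie algebras; (b) there is a Manin triple of endo Lie algebras associated to $(\mathfrak g,[\,,]_{\mathfrak g},\phi)$ and $(\mathfrak g^*,[\,,]_{\mathfrak g^*},\psi^* )$; (c) the triple $(\mathfrak g,[\,,]_{\mathfrak g},\delta)$ is a Lie bialgebra and, furthermore, the linear operators $\phi^*$ and $\psi$ dually represent $(\mathfrak g^*,\psi^* )$ and $(\mathfrak g,\phi)$ respectively.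
   Context: An endo Lie algebra $(\mathfrak g,\phi)$ is a Lie algebra $\mathfrak g$ with a Lie algebra endomorphism $\phi$. A representation of $(\mathfrak g,\phi)$ is $(V,\rho,\alpha)$ with $(V,\rho)$ a representation of $\mathfrak g$ and $\alpha\in\mathrm{End}(V)$ such that $\alpha(\rho(x)v)=\rho(\phi(x))(\alpha(v))$ for all $x\in\mathfrak g,v\in V$. For a representation $(V,\rho)$, $\rho^*(x):=-\rho(x)^*$ on $V^*$; $\mathrm{ad}_{\mathfrak g}^*$ acts on $\mathfrak g^*$ and $\mathrm{ad}_{\mathfrak g^*}^*$ acts on $\mathfrak g^{**}=\mathfrak g$. A linear operator $\psi$ on $\mathfrak g$ dually represents $(\mathfrak g,\phi)$ if $(\mathfrak g^*,\mathrm{ad}^*,\psi^* )$ is a representation of $(\mathfrak g,\phi)$, equivalently $\psi[\phi(x),y]=[x,\psi(y)]$ for all $x,y\in\mathfrak g$. Matched pair of Lie algebras: $(\mathfrak g,\mathfrak h,\rho,\mu)$ with $\mathfrak g,\mathfrak h$ Lie algebras, $\rho:\mathfrak g\to\mathrm{End}(\mathfrak h)$ and $\mu:\mathfrak h\to\mathrm{End}(\mathfrak g)$ representations such that for all $x,y\in\mathfrak g$, $a,b\in\mathfrak h$: $\rho(x)[a,b]-[\rho(x)a,b]-[a,\rho(x)b]+\rho(\mu(a)x)b-\rho(\mu(b)x)a=0$ and $\mu(a)[x,y]-[\mu(a)x,y]-[x,\mu(a)y]+\mu(\rho(x)a)y-\mu(\rho(y)a)x=0$. A matched pair of endo Lie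 algebras $((\mathfrak g,\phi_{\mathfrak g}),(\mathfrak h,\phi_{\mathfrak h}),\rho,\mu)$ consists of endo Lie algebras such that $(\mathfrak g,\mathfrak h,\rho,\mu)$ is a matched pair of Lie algebras, $(\mathfrak g,\mu,\phi_{\mathfrak g})$ is a representation of $(\mathfrak h,\phi_{\mathfrak h})$ and $(\mathfrak h,\rho,\phi_{\mathfrak h})$ is a representation of $(\mathfrak g,\phi_{\mathfrak g})$. A Manin triple of Lie algebras associated to $\mathfrak g$ and $\mathfrak g^*$ is a Lie algebra structure on $\mathfrak g\oplus\mathfrak g^*$ (denoted $\mathfrak g\bowtie\mathfrak g^*$) containing both as Lie subalgebras and for which the bilinear form $\mathfrak B_d(x+a^*,y+b^* )=\langle x,b^*\rangle+\langle a^*,y\rangle$ is invariant: $\mathfrak B_d([u,v],w)=\mathfrak B_d(u,[v,w])$. A Manin triple of endo Lie algebras associated to $(\mathfrak g,\phi)$ and $(\mathfrak g^*,\psi^* )$ is such a Manin triple for which $\phi+\psi^*:x+a^*\mapsto\phi(x)+\psi^*(a^* )$ is a Lie algebra endomorphism of $\mathfrak g\bowtie\mathfrak g^*$. Lie bialgebra: $(\mathfrak g,[\,,],\delta)$ with $\mathfrak g$ a Lie algebra, $(\mathfrak g,\delta)$ a Lie coalgebra (in finite dimension: $\delta^*$ is a Lie bracket on $\mathfrak g^*$) and $\delta[x,y]=(\mathrm{ad}(x)\otimes\mathrm{id}+\mathrm{id}\otimes\mathrm{ad}(x))\delta(y)-(\mathrm{ad}(y)\otimes\mathrm{id}+\mathrm{id}\otimes\mathrm{ad}(y))\delta(x)$.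 *)

(* Defs.v *)
From HB Require Import structures.
From mathcomp Require Import all_boot all_order all_algebra.

Set Implicit Arguments.
Unset Strict Implicit.
Unset Printing Implicit Defensive.

Import GRing.Theory.
Local Open Scope ring_scope.

(* A [vectType K] is a finite-dimensional K-vector space.  Maps built with      *)
(* [linfun f] agree with f only when f is linear; each such use below comes     *)
(* with a lemma giving its value.                                               *)

Lemma linfun_linearE (K : fieldType) (U V : vectType K) (f : U -> V) :
  linear f -> linfun f =1 f.
Proof.
move=> lin.
pose G : {linear U -> V} := HB.pack f (GRing.isLinear.Build K U V _ f lin).
exact: (lfunE G).
Qed.

Section Duality.
Variable K : fieldType.
Implicit Types V W : vectType K.

Definition dual V : vectType K := 'Hom(V, K^o).

Definition pairing V (a : dual V) (v : V) : K := (a : 'Hom(V, K^o)) v.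

Definition mk_dual V (f : V -> K) : dual V := linfun (f : V -> K^o).

Lemma mk_dualE V (f : V -> K) : scalar f -> forall v, pairing (mk_dual f) v = f v.
Proof. by move=> lin v; exact: (@linfun_linearE K V K^o f lin v). Qed.

Lemma pairingPr V (a : dual V) k v w :
  pairing a (k *: v + w) = k * pairing a v + pairing a w.
Proof. by rewrite /pairing linearP. Qed.

Lemma pairingPl V k (a b : dual V) v :
  pairing (k *: a + b) v = k * pairing a v + pairing b v.
Proof. by rewrite /pairing add_lfunE scale_lfunE. Qed.

Lemma pairingNl V (a : dual V) v : pairing (- a) v = - pairing a v.
Proof. by rewrite /pairing opp_lfunE. Qed.

Lemma dual_ext V (a b : dual V) : (forall v, pairing a v = pairing b v) -> a = b.
Proof. by move=> e; apply/lfunP. Qed.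

Definition transpose V W (f : 'Hom(V, W)) : 'Hom(dual W, dual V) :=
  linfun (fun a : dual W => mk_dual (fun v => pairing a (f v))).

Lemma transposeE V W (f : 'Hom(V, W)) (a : dual W) v :
  pairing (transpose f a) v = pairing a (f v).
Proof.
have E (b : dual W) u :
    pairing (mk_dual (fun v => pairing b (f v))) u = pairing b (f u).
  by rewrite mk_dualE // => k x y; rewrite linearP pairingPr.
rewrite /transpose linfun_linearE ?E // => k b c.
by apply: dual_ext => x; rewrite pairingPl !E pairingPl.
Qed.

Definition bidual V : 'Hom(V, dual (dual V)) :=
  linfun (fun v : V => mk_dual (fun a : dual V => pairing a v)).

Lemma bidualE V (v : V) (a : dual V) : pairing (bidual V v) a = pairing a v.
Proof.
have E u b : pairing (mk_dual (fun a : dual V => pairing a u)) b = pairing b u.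
  by rewrite mk_dualE // => k x y; rewrite pairingPl.
rewrite /bidual linfun_linearE ?E // => k x y.
by apply: dual_ext => b; rewrite pairingPl !E pairingPr.
Qed.

Definition coord_form V (i : 'I_(\dim {:V})) : dual V :=
  mk_dual (coord (vbasis {:V}) i).

Lemma vbasis_expand V (v : V) :
  v = \sum_(i < \dim {:V}) pairing (coord_form i) v *: (vbasis {:V})`_i.
Proof.
rewrite {1}(coord_vbasis (memvf v)); apply: eq_bigr => i _.
by rewrite mk_dualE // => k x y; rewrite linearP.
Qed.

Lemma pairing_sep V (v w : V) :
  (forall a : dual V, pairing a v = pairing a w) -> v = w.
Proof.
move=> e; rewrite (vbasis_expand v) (vbasis_expand w).
by apply: eq_bigr => i _; rewrite e.
Qed.

Lemma dual_expand V (a : dual V) :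
  a = \sum_(i < \dim {:V}) pairing a (vbasis {:V})`_i *: coord_form i.
Proof.
apply: dual_ext => v; rewrite {1}(vbasis_expand v) /pairing linear_sum sum_lfunE.
by apply: eq_bigr => i _; rewrite linearZ scale_lfunE; exact: mulrC.
Qed.

Definition bidual_inv V : 'Hom(dual (dual V), V) := (bidual V)^-1%VF.

Lemma bidualK V : cancel (bidual V) (bidual_inv V).
Proof.
apply: lker0_lfunK; apply/lker0P => v w e.
by apply: pairing_sep => a; rewrite -bidualE e bidualE.
Qed.

Lemma bidual_invK V : cancel (bidual_inv V) (bidual V).
Proof.
move=> F; suff [v ->] : exists v, F = bidual V v by rewrite bidualK.
exists (\sum_(i < \dim {:V}) pairing F (coord_form i) *: (vbasis {:V})`_i).
apply: dual_ext => a; rewrite bidualE {1}(dual_expand a) /pairing !linear_sum.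
by apply: eq_bigr => i _; rewrite !linearZ; exact: mulrC.
Qed.

Lemma bidual_invE V (F : dual (dual V)) (a : dual V) :
  pairing a (bidual_inv V F) = pairing F a.
Proof. by rewrite -bidualE bidual_invK. Qed.

End Duality.

(* The tensor product of finite-dimensional spaces, modelled as Hom(V^*, W)     *)
(* with v (x) w : a |-> a(v) w; [tensor_universal] is its universal property.   *)
Section Tensor.
Variable K : fieldType.
Implicit Types U V W : vectType K.

Definition tensor V W : vectType K := 'Hom(dual V, W).

Definition contract V W (t : tensor V W) (a : dual V) : W :=
  (t : 'Hom(dual V, W)) a.

Lemma contractPl V W k (s t : tensor V W) a :
  contract (k *: s + t) a = k *: contract s a + contract t a.
Proof. by rewrite /contract add_lfunE scale_lfunE. Qed.

Lemma contractPr V W (t : tensor V W) k a b :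
  contract t (k *: a + b) = k *: contract t a + contract t b.
Proof. by rewrite /contract linearP. Qed.

Lemma tensor_ext V W (s t : tensor V W) :
  (forall a, contract s a = contract t a) -> s = t.
Proof. by move=> e; apply/lfunP. Qed.

Definition pure V W (v : V) (w : W) : tensor V W :=
  linfun (fun a : dual V => pairing a v *: w).

Lemma pureE V W (v : V) (w : W) (a : dual V) :
  contract (pure v w) a = pairing a v *: w.
Proof.
rewrite /contract /pure linfun_linearE // => k b c.
by rewrite pairingPl scalerDl scalerA.
Qed.

Lemma pure_bilinear V W : bilinear_for *:%R *:%R (@pure V W).
Proof.
split=> [w|v] k x y; apply: tensor_ext => a; rewrite contractPl !pureE.
  by rewrite pairingPr scalerDl scalerA.
by rewrite scalerDr !scalerA mulrC.
Qed.

Lemma tensor_expand V W (t : tensor V W) :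
  t = \sum_(i < \dim {:V}) pure (vbasis {:V})`_i (contract t (coord_form i)).
Proof.
apply: tensor_ext => a; rewrite {1}(dual_expand a) /contract linear_sum sum_lfunE.
by apply: eq_bigr => i _; rewrite linearZ -[RHS]/(contract _ _) pureE.
Qed.

Lemma tensor_universal U V W (f : V -> W -> U) :
    bilinear_for *:%R *:%R f ->
  exists! F : 'Hom(tensor V W, U), forall v w, F (pure v w) = f v w.
Proof.
case=> fl fr.
pose h (t : tensor V W) :=
  \sum_(i < \dim {:V}) f (vbasis {:V})`_i (contract t (coord_form i)).
have lin : linear h.
  move=> k s t; rewrite /h scaler_sumr -big_split; apply: eq_bigr => i _ /=.
  by rewrite contractPl fr.
have f0l w : f 0 w = 0.
  by have := fl w (-1) 0 0; rewrite /= scaler0 addr0 scaleN1r addNr.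
have fZr k v w : f v (k *: w) = k *: f v w.
  have f0 : f v 0 = 0.
    by have := fr v (-1) 0 0; rewrite /= scaler0 addr0 scaleN1r addNr.
  by have := fr v k w 0; rewrite !addr0 f0 addr0.
have fZl k v w : f (k *: v) w = k *: f v w.
  by have := fl w k v 0; rewrite /= !addr0 f0l addr0.
have fDl v v' w : f (v + v') w = f v w + f v' w.
  by have := fl w 1 v v'; rewrite /= !scale1r.
exists (linfun h); split=> [v w|F eF].
  rewrite (linfun_linearE lin) /h {2}(vbasis_expand v).
  rewrite (big_morph (f^~ w) (fun x y => fDl x y w) (f0l w)).
  by apply: eq_bigr => i _; rewrite pureE fZr fZl.
apply/lfunP => t; rewrite (linfun_linearE lin) /h [in RHS](tensor_expand t).
by rewrite linear_sum; apply: eq_bigr => i _; rewrite -eF.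
Qed.

Definition tensor_map V V' W W' (f : 'Hom(V, V')) (h : 'Hom(W, W')) :
    'Hom(tensor V W, tensor V' W') :=
  linfun (fun t : tensor V W =>
    linfun (fun a : dual V' => h (contract t (transpose f a))) : tensor V' W').

Lemma contract_tensor_map V V' W W' (f : 'Hom(V, V')) (h : 'Hom(W, W')) t a :
  contract (tensor_map f h t) a = h (contract t (transpose f a)).
Proof.
have E (s : tensor V W) b :
    contract (linfun (fun a => h (contract s (transpose f a)))) b =
    h (contract s (transpose f b)).
  by rewrite {1}/contract linfun_linearE // => k c d;
    rewrite linearP contractPr linearP.
rewrite /tensor_map linfun_linearE ?E // => k s s'.
by apply: tensor_ext => b; rewrite contractPl !E contractPl linearP.
Qed.

Lemma tensor_mapE V V' W W' (f : 'Hom(V, V')) (h : 'Hom(W, W')) v w :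
  tensor_map f h (pure v w) = pure (f v) (h w).
Proof.
apply: tensor_ext => a; rewrite contract_tensor_map !pureE.
by rewrite linearZ transposeE.
Qed.

(* <a (x) b, t> for the identification (V (x) W)^* = V^* (x) W^*.               *)
Definition tensor_pairing V W (a : dual V) (b : dual W) (t : tensor V W) : K :=
  pairing b (contract t a).

Lemma tensor_pairingE V W (a : dual V) (b : dual W) v w :
  tensor_pairing a b (pure v w) = pairing a v * pairing b w.
Proof. by rewrite /tensor_pairing pureE /pairing linearZ. Qed.

Lemma tensor_pairing_sep V W (s t : tensor V W) :
  (forall a b, tensor_pairing a b s = tensor_pairing a b t) -> s = t.
Proof.
by move=> e; apply: tensor_ext => a; apply: pairing_sep => b; apply: e.
Qed.

(* The dual V -> V (x) V of m : V^* (x) V^* -> V^*, using V^** = V.             *)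
Definition dual_mult V (m : dual V -> dual V -> dual V) :
    'Hom(V, tensor V V) :=
  linfun (fun x : V => linfun (fun a : dual V =>
    bidual_inv V (mk_dual (fun b : dual V => pairing (m a b) x))) : tensor V V).

Lemma dual_multE V (m : dual V -> dual V -> dual V) :
    bilinear_for *:%R *:%R m ->
  forall x a b, tensor_pairing a b (dual_mult m x) = pairing (m a b) x.
Proof.
case=> ml mr.
pose f1 x a := bidual_inv V (mk_dual (fun b : dual V => pairing (m a b) x)).
have E1 x a b : pairing b (f1 x a) = pairing (m a b) x.
  by rewrite bidual_invE mk_dualE // => k c d; rewrite mr pairingPl.
pose f2 x : tensor V V := linfun (f1 x).
have E2 x a b : tensor_pairing a b (f2 x) = pairing (m a b) x.
  rewrite /tensor_pairing /contract linfun_linearE ?E1 // => k c d.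
  apply: pairing_sep => e; rewrite pairingPr !E1.
  by have /= -> := ml e k c d; rewrite pairingPl.
move=> x a b; rewrite -[dual_mult m]/(linfun f2) linfun_linearE ?E2 // => k y z.
apply: tensor_pairing_sep => c d.
rewrite {2}/tensor_pairing contractPl [RHS]pairingPr.
by rewrite -!/(tensor_pairing _ _ _) !E2 pairingPr.
Qed.

(* The dual V^* (x) V^* -> V^* of d : V -> V (x) V.                             *)
Definition dual_comult V (d : 'Hom(V, tensor V V)) (a b : dual V) : dual V :=
  mk_dual (fun x => tensor_pairing a b (d x)).

Lemma dual_comultE V (d : 'Hom(V, tensor V V)) (a b : dual V) x :
  pairing (dual_comult d a b) x = tensor_pairing a b (d x).
Proof.
rewrite mk_dualE // => k y z.
by rewrite /tensor_pairing linearP contractPl pairingPr.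
Qed.

End Tensor.

Section Lie.
Variable K : fieldType.
Implicit Types g h V : vectType K.

Record is_lie_bracket g (br : g -> g -> g) : Prop := IsLieBracket {
  lie_bilinear : bilinear_for *:%R *:%R br;
  lie_alternating : forall x, br x x = 0;
  lie_jacobi : forall x y z,
    br x (br y z) + br y (br z x) + br z (br x y) = 0 }.

Definition is_lie_endo g (br : g -> g -> g) (f : 'End(g)) : Prop :=
  forall x y, f (br x y) = br (f x) (f y).

Definition is_endo_lie g (br : g -> g -> g) (phi : 'End(g)) : Prop :=
  is_lie_bracket br /\ is_lie_endo br phi.

Definition is_rep g (br : g -> g -> g) V (rho : 'Hom(g, 'End(V))) : Prop :=
  forall x y v, rho (br x y) v = rho x (rho y v) - rho y (rho x v).

Definition is_endo_rep g (br : g -> g -> g) (phi : 'End(g))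
    V (rho : 'Hom(g, 'End(V))) (alpha : 'End(V)) : Prop :=
  is_rep br rho /\ forall x v, alpha (rho x v) = rho (phi x) (alpha v).

Definition ad g (br : g -> g -> g) : 'Hom(g, 'End(g)) :=
  linfun (fun x : g => linfun (br x)).

Lemma adE g (br : g -> g -> g) :
  bilinear_for *:%R *:%R br -> forall x y, ad br x y = br x y.
Proof.
case=> bl brr x y.
have E z w : linfun (br z) w = br z w.
  by rewrite (linfun_linearE (brr z)).
have lin : linear (fun x : g => linfun (br x)).
  move=> k z w; apply/lfunP => u; rewrite add_lfunE scale_lfunE !E.
  exact: bl u k z w.
by rewrite /ad (linfun_linearE lin) /= E.
Qed.

Definition dual_rep g V (rho : 'Hom(g, 'End(V))) : 'Hom(g, 'End(dual V)) :=
  linfun (fun x : g => - transpose (rho x)).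

Lemma dual_repE g V (rho : 'Hom(g, 'End(V))) x (a : dual V) v :
  pairing (dual_rep rho x a) v = - pairing a (rho x v).
Proof.
have lin : linear (fun x : g => - transpose (rho x)).
  move=> k y z; apply/lfunP => b; apply: dual_ext => w.
  rewrite add_lfunE scale_lfunE !opp_lfunE pairingPl !pairingNl !transposeE.
  by rewrite linearP add_lfunE scale_lfunE pairingPr opprD mulrN.
by rewrite /dual_rep (linfun_linearE lin) opp_lfunE pairingNl transposeE.
Qed.

Definition coad g (br : g -> g -> g) : 'Hom(g, 'End(dual g)) :=
  dual_rep (ad br).

Definition transport_rep g V W (f : 'Hom(V, W)) (f' : 'Hom(W, V))
    (rho : 'Hom(g, 'End(W))) : 'Hom(g, 'End(V)) :=
  linfun (fun x : g => (f' \o rho x \o f)%VF).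

Lemma transport_repE g V W (f : 'Hom(V, W)) (f' : 'Hom(W, V))
    (rho : 'Hom(g, 'End(W))) x v :
  transport_rep f f' rho x v = f' (rho x (f v)).
Proof.
have lin : linear (fun x : g => (f' \o rho x \o f)%VF).
  move=> k y z; apply/lfunP => w.
  rewrite add_lfunE scale_lfunE !comp_lfunE linearP.
  by rewrite add_lfunE scale_lfunE linearP.
by rewrite /transport_rep (linfun_linearE lin) !comp_lfunE.
Qed.

(* The coadjoint action of a Lie algebra g^*, carried from g^** to g.           *)
Definition coad_bidual g (br : dual g -> dual g -> dual g) :
    'Hom(dual g, 'End(g)) :=
  transport_rep (bidual g) (bidual_inv g) (coad br).

Lemma coad_bidualE g (br : dual g -> dual g -> dual g) :
    bilinear_for *:%R *:%R br ->
  forall (a b : dual g) x, pairing b (coad_bidual br a x) = - pairing (br a b) x.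
Proof.
move=> brl a b x.
by rewrite transport_repE bidual_invE dual_repE bidualE adE.
Qed.

Definition dually_represents g (br : g -> g -> g) (phi psi : 'End(g)) : Prop :=
  is_endo_rep br phi (coad br) (transpose psi).

Record is_matched_pair g h (brg : g -> g -> g) (brh : h -> h -> h)
    (rho : 'Hom(g, 'End(h))) (mu : 'Hom(h, 'End(g))) : Prop := IsMatchedPair {
  mp_lie_l : is_lie_bracket brg;
  mp_lie_r : is_lie_bracket brh;
  mp_rep_l : is_rep brg rho;
  mp_rep_r : is_rep brh mu;
  mp_compat_l : forall (x : g) (a b : h),
    rho x (brh a b) - brh (rho x a) b - brh a (rho x b)
      + rho (mu a x) b - rho (mu b x) a = 0;
  mp_compat_r : forall (a : h) (x y : g),
    mu a (brg x y) - brg (mu a x) y - brg x (mu a y)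
      + mu (rho x a) y - mu (rho y a) x = 0 }.

Record is_endo_matched_pair g h
    (brg : g -> g -> g) (phig : 'End(g)) (brh : h -> h -> h) (phih : 'End(h))
    (rho : 'Hom(g, 'End(h))) (mu : 'Hom(h, 'End(g))) : Prop :=
  IsEndoMatchedPair {
  emp_endo_l : is_endo_lie brg phig;
  emp_endo_r : is_endo_lie brh phih;
  emp_matched : is_matched_pair brg brh rho mu;
  emp_rep_r : is_endo_rep brh phih mu phig;
  emp_rep_l : is_endo_rep brg phig rho phih }.

Definition manin_form g (u v : (g * dual g)%type) : K :=
  pairing v.2 u.1 + pairing u.2 v.1.

Record is_manin_triple g (brg : g -> g -> g) (brd : dual g -> dual g -> dual g)
    (B : g * dual g -> g * dual g -> g * dual g) : Prop := IsManinTriple {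
  mt_lie : is_lie_bracket B;
  mt_sub_l : forall x y, B (x, 0) (y, 0) = (brg x y, 0);
  mt_sub_r : forall a b, B (0, a) (0, b) = (0, brd a b);
  mt_invariant : forall u v w,
    manin_form (B u v) w = manin_form u (B v w) }.

Definition oplus g h (f : 'End(g)) (k : 'End(h)) : 'End((g * h)%type) :=
  linfun (fun u : g * h => (f u.1, k u.2)).

Lemma oplusE g h (f : 'End(g)) (k : 'End(h)) u :
  oplus f k u = (f u.1, k u.2).
Proof.
have lin : linear (fun u : g * h => (f u.1, k u.2)).
  by move=> c v w; rewrite /= !linearP.
by rewrite /oplus (linfun_linearE lin).
Qed.

Definition is_endo_manin_triple g (brg : g -> g -> g) (phi : 'End(g))
    (brd : dual g -> dual g -> dual g) (psid : 'End(dual g))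
    (B : g * dual g -> g * dual g -> g * dual g) : Prop :=
  is_manin_triple brg brd B /\ is_lie_endo B (oplus phi psid).

Definition is_lie_coalgebra g (delta : 'Hom(g, tensor g g)) : Prop :=
  is_lie_bracket (dual_comult delta).

Definition ad_tensor g (br : g -> g -> g) (x : g) : 'End(tensor g g) :=
  tensor_map (ad br x) \1%VF + tensor_map \1%VF (ad br x).

Record is_lie_bialgebra g (br : g -> g -> g) (delta : 'Hom(g, tensor g g)) :
    Prop := IsLieBialgebra {
  lb_lie : is_lie_bracket br;
  lb_colie : is_lie_coalgebra delta;
  lb_cocycle : forall x y,
    delta (br x y) = ad_tensor br x (delta y) - ad_tensor br y (delta x) }.

End Lie.

(* Main.v *)
(** Every condition is tested by pairing elements of [g] with elements of
    [g^*].  Invariance of the form forces the mixed brackets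
    [x, b] = ad^*(x) b - ad^*(b) x, and each of the compatibility equations of the
    matched pair, as well as the mixed Jacobi identities of the Manin triple,
    becomes, once paired, the single scalar identity [cocycle_identity].
    In the same way the compatibility of [phi + psi^*] with the mixed brackets
    splits into the two dual representation conditions. *)
Require Import Defs.
From mathcomp Require Import all_boot all_order all_algebra.
From mathcomp Require Import ring.

Set Implicit Arguments.
Unset Strict Implicit.
Unset Printing Implicit Defensive.

Import GRing.Theory.
Local Open Scope ring_scope.

(** * Linearity of the pairing in each argument *)

Section Pairing.
Variables (K : fieldType) (V : vectType K).
Implicit Types (a b : dual V) (v w : V).

Lemma pairingDl a b v : pairing (a + b) v = pairing a v + pairing b v.
Proof. by rewrite /pairing add_lfunE. Qed.

Lemma pairing0l v : pairing 0 v = 0.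
Proof. by rewrite /pairing zero_lfunE. Qed.

Lemma pairingDr a v w : pairing a (v + w) = pairing a v + pairing a w.
Proof. by rewrite /pairing linearD. Qed.

Lemma pairingNr a v : pairing a (- v) = - pairing a v.
Proof. by rewrite /pairing linearN. Qed.

Lemma pairing0r a : pairing a 0 = 0.
Proof. by rewrite /pairing linear0. Qed.

Lemma pairingZl k a v : pairing (k *: a) v = k * pairing a v.
Proof. by rewrite /pairing scale_lfunE. Qed.

Lemma pairingZr a k v : pairing a (k *: v) = k * pairing a v.
Proof. by rewrite /pairing linearZ. Qed.

Definition pairingE :=
  (pairingDl, pairingNl, pairingZl, pairing0l,
   pairingDr, pairingNr, pairingZr, pairing0r).

End Pairing.

(** * Elementary Lie bracket identities and the coadjoint representation *)

Section LieBracket.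
Variables (K : fieldType) (g : vectType K) (br : g -> g -> g).
Hypothesis br_lie : is_lie_bracket br.

Lemma lieDl x y z : br (x + y) z = br x z + br y z.
Proof. by have [/(_ z 1 x y) /= + _] := lie_bilinear br_lie; rewrite !scale1r. Qed.

Lemma lieDr x y z : br x (y + z) = br x y + br x z.
Proof. by have [_ /(_ x 1 y z) /=] := lie_bilinear br_lie; rewrite !scale1r. Qed.

Lemma lie0r x : br x 0 = 0.
Proof. by apply: (addrI (br x 0)); rewrite -lieDr !addr0. Qed.

Lemma lie0l x : br 0 x = 0.
Proof. by apply: (addrI (br 0 x)); rewrite -lieDl !addr0. Qed.

Lemma lieNr x y : br x (- y) = - br x y.
Proof. by apply: (addrI (br x y)); rewrite -lieDr !subrr lie0r. Qed.

Lemma lieNl x y : br (- x) y = - br x y.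
Proof. by apply: (addrI (br x y)); rewrite -lieDl !subrr lie0l. Qed.

Lemma lieC x y : br x y = - br y x.
Proof.
apply/eqP; rewrite -addr_eq0; apply/eqP.
have := lie_alternating br_lie (x + y).
by rewrite lieDl !lieDr !(lie_alternating br_lie) add0r addr0.
Qed.

Lemma lie_leibniz x y z : br (br x y) z = br x (br y z) - br y (br x z).
Proof.
have /eqP := lie_jacobi br_lie x y z; rewrite addrC addr_eq0 => /eqP e.
by rewrite lieC e opprK (lieC z) lieNr.
Qed.

Lemma coad_pairing x (a : dual g) y :
  pairing (coad br x a) y = - pairing a (br x y).
Proof. by rewrite dual_repE (adE (lie_bilinear br_lie)). Qed.

Lemma coad_rep : is_rep br (coad br).
Proof.
move=> x y a; apply: dual_ext => z; rewrite !pairingE !coad_pairing.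
by rewrite lie_leibniz !pairingE; ring.
Qed.

End LieBracket.

(** Serves to pass from [brd] to [dual_comult (dual_mult brd)], which agrees with it only pointwise,
    without functional extensionality. *)
Lemma eq_is_lie_bracket (K : fieldType) (g : vectType K) (br br' : g -> g -> g) :
  br =2 br' -> is_lie_bracket br -> is_lie_bracket br'.
Proof.
move=> e [[bl brr] alt jac]; split=> [|x|x y z]; last 2 first.
- by rewrite -e.
- by rewrite -!e.
by split=> [z k x y|z k x y] /=; rewrite -!e; [exact: bl | exact: brr].
Qed.

(** * The Lie algebra built from a matched pair *)

Section Bowtie.
Variable K : fieldType.

(** The bicrossed sum, whose mixed bracket is [x, b] = [rho x b - mu b x]. *)
Definition bowtie (g h : vectType K) (brg : g -> g -> g) (brh : h -> h -> h)
    (rho : 'Hom(g, 'End(h))) (mu : 'Hom(h, 'End(g))) (u v : g * h) : g * h :=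
  (brg u.1 v.1 + mu u.2 v.1 - mu v.2 u.1,
   brh u.2 v.2 + rho u.1 v.2 - rho v.1 u.2).

Lemma matched_pair_sym (g h : vectType K) brg brh
    (rho : 'Hom(g, 'End(h))) (mu : 'Hom(h, 'End(g))) :
  is_matched_pair brg brh rho mu -> is_matched_pair brh brg mu rho.
Proof. by case. Qed.

(** This component combines the Jacobi identity of [g], the representation property of [mu] and the
    compatibility equation for [mu a (brg x y)]. *)
Lemma bowtie_jacobi_fst (g h : vectType K) brg brh
    (rho : 'Hom(g, 'End(h))) (mu : 'Hom(h, 'End(g))) :
  is_matched_pair brg brh rho mu ->
  let B := bowtie brg brh rho mu in
  forall u v w, (B u (B v w) + B v (B w u) + B w (B u v)).1 = 0.
Proof.
case=> lg _ _ mu_rep _ compat B [x a] [y b] [z c].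
rewrite /B /bowtie /=; apply: pairing_sep => f.
(* The compatibility equation is solved for its leading term, with [brg (mu t p) q] reversed so that
   every [mu] value is a second argument. After this rewriting and [jac], equal terms are
   syntactically equal for [ring]. *)
have mu_br t p q : pairing f (mu t (brg p q)) =
    - pairing f (brg q (mu t p)) + pairing f (brg p (mu t q))
    - pairing f (mu (rho p t) q) + pairing f (mu (rho q t) p).
  have := congr1 (pairing f) (compat t p q).
  rewrite !pairingE (lieC lg (mu t p)) !pairingE => e.
  by apply/eqP; rewrite -subr_eq0 -e; apply/eqP; ring.
have jac : pairing f (brg x (brg y z)) =
    - pairing f (brg y (brg z x)) - pairing f (brg z (brg x y)).
  have := congr1 (pairing f) (lie_jacobi lg x y z); rewrite !pairingE => e.
  by apply/eqP; rewrite -subr_eq0 -e; apply/eqP; ring.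
rewrite !(lieDr lg) !(lieNr lg) !linearD !linearN.
rewrite !(add_lfunE, opp_lfunE) !mu_rep !pairingE !mu_br jac.
ring.
Qed.

Lemma bowtie_lie (g h : vectType K) brg brh
    (rho : 'Hom(g, 'End(h))) (mu : 'Hom(h, 'End(g))) :
  is_matched_pair brg brh rho mu -> is_lie_bracket (bowtie brg brh rho mu).
Proof.
move=> mp; have [lg lh _ _ _ _] := mp.
have [[glin glinr] galt _] := lg; have [[hlin hlinr] halt _] := lh.
split=> [|[x a]|u v w]; last 2 first.
- by rewrite /bowtie /= galt halt !add0r !subrr.
- apply: injective_projections; first exact: bowtie_jacobi_fst.
  (* Exchanging the two components turns [bowtie] into the bracket of the swapped matched pair, so
     the second component is a first component there. *)
  by have := bowtie_jacobi_fst (matched_pair_sym mp) (u.2, u.1) (v.2, v.1) (w.2, w.1).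
split=> [[z c] k [x a] [y b]|[z c] k [x a] [y b]] /=; rewrite /bowtie /=;
  apply: injective_projections => /=; apply: pairing_sep => f;
  [have /= -> := glin z k x y | have /= -> := hlin c k a b
  |have /= -> := glinr z k x y | have /= -> := hlinr c k a b];
  by rewrite !linearP !(add_lfunE, scale_lfunE) !pairingE; ring.
Qed.

End Bowtie.

(** * The coadjoint matched pair, the Lie bialgebra and the cocycle condition *)

Section Double.
Variables (K : fieldType) (g : vectType K).
Variables (br : g -> g -> g) (brd : dual g -> dual g -> dual g).
Hypotheses (br_lie : is_lie_bracket br) (brd_lie : is_lie_bracket brd).

Local Notation rho := (coad br).
Local Notation mu := (coad_bidual brd).

Lemma coad_bidual_pairing a b x :
  pairing b (mu a x) = - pairing (brd a b) x.
Proof. exact: coad_bidualE (lie_bilinear brd_lie) a b x. Qed.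

Lemma coad_bidual_rep : is_rep brd mu.
Proof.
move=> a b x; apply: pairing_sep => c; rewrite !pairingE !coad_bidual_pairing.
by rewrite (lie_leibniz brd_lie) !pairingE; ring.
Qed.

(** The cocycle condition of the bialgebra evaluated on a (x) b, with [delta] expressed through
    [brd] and the adjoint actions moved to the dual side. *)
Definition cocycle_identity : Prop := forall x y a b,
  pairing (brd a b) (br x y) =
    pairing (brd (rho y a) b) x + pairing (brd a (rho y b)) x
    - pairing (brd (rho x a) b) y - pairing (brd a (rho x b)) y.

Lemma coad_matched_pairP :
  is_matched_pair br brd rho mu <-> cocycle_identity.
Proof.
(* By antisymmetry the bracket is minus ad(y) applied to [mu a x]; then ad(y) and [mu a] are moved
   in turn to the dual side. *)
have brl a b x y : pairing b (br (mu a x) y) = - pairing (brd a (rho y b)) x.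
  by rewrite (lieC br_lie) pairingNr -(coad_pairing br_lie) coad_bidual_pairing.
have rhol a b x y : pairing (rho (mu a x) b) y = pairing (brd a (rho y b)) x.
  by rewrite (coad_pairing br_lie) brl opprK.
(* The defect of the first compatibility equation paired with [y] and that of the second paired with
   [b] ([Er]) are the same scalar, namely the defect of [cocycle_identity]. *)
have El x y a b : pairing (rho x (brd a b) - brd (rho x a) b - brd a (rho x b)
      + rho (mu a x) b - rho (mu b x) a) y =
    pairing (brd (rho y a) b) x + pairing (brd a (rho y b)) x
    - pairing (brd (rho x a) b) y - pairing (brd a (rho x b)) y
    - pairing (brd a b) (br x y).
  rewrite !pairingE !rhol (coad_pairing br_lie) (lieC brd_lie b).
  by rewrite pairingNl; ring.
have Er x y a b : pairing b (mu a (br x y) - br (mu a x) y - br x (mu a y)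
      + mu (rho x a) y - mu (rho y a) x) =
    pairing (brd (rho y a) b) x + pairing (brd a (rho y b)) x
    - pairing (brd (rho x a) b) y - pairing (brd a (rho x b)) y
    - pairing (brd a b) (br x y).
  rewrite !pairingE (lieC br_lie x (mu a y)) pairingNr !brl.
  by rewrite !coad_bidual_pairing; ring.
split=> [[_ _ _ _ compat _] x y a b|cocy].
  by apply/eqP; rewrite eq_sym -subr_eq0 -El compat pairing0l.
split=> // [||x a b|a x y].
- exact: coad_rep.
- exact: coad_bidual_rep.
- by apply: dual_ext => y; rewrite El cocy subrr pairing0l.
- by apply: pairing_sep => b; rewrite Er cocy subrr pairing0r.
Qed.

Lemma dual_comultK a b : dual_comult (dual_mult brd) a b = brd a b.
Proof.
by apply: dual_ext => x; rewrite dual_comultE (dual_multE (lie_bilinear brd_lie)).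
Qed.

(** The transpose of [ad br x] is [- rho x], so each tensor leg contributes a coadjoint action with
    a minus sign. *)
Lemma tensor_pairing_ad (x : g) (t : tensor g g) (a b : dual g) :
  tensor_pairing a b (ad_tensor br x t) =
    - tensor_pairing (rho x a) b t - tensor_pairing a (rho x b) t.
Proof.
have coadE c : transpose (ad br x) c = - rho x c.
  apply: dual_ext => y.
  by rewrite transposeE pairingNl (coad_pairing br_lie) opprK
    (adE (lie_bilinear br_lie)).
have contractNr c : contract t (- c) = - contract t c.
  by rewrite /contract linearN.
have transpose1 : transpose \1%VF a = a.
  by apply: dual_ext => y; rewrite transposeE id_lfunE.
have -> : tensor_pairing a b (ad_tensor br x t) =
    tensor_pairing a b (tensor_map (ad br x) \1%VF t)
    + tensor_pairing a b (tensor_map \1%VF (ad br x) t).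
  by rewrite /tensor_pairing /ad_tensor /contract !add_lfunE pairingDr.
rewrite /tensor_pairing !contract_tensor_map id_lfunE coadE transpose1.
by rewrite contractNr pairingNr -transposeE coadE pairingNl.
Qed.

Lemma lie_bialgebraP :
  is_lie_bialgebra br (dual_mult brd) <-> cocycle_identity.
Proof.
have dE := dual_multE (lie_bilinear brd_lie).
have E x y a b : tensor_pairing a b
      (ad_tensor br x (dual_mult brd y) - ad_tensor br y (dual_mult brd x)) =
    pairing (brd (rho y a) b) x + pairing (brd a (rho y b)) x
    - pairing (brd (rho x a) b) y - pairing (brd a (rho x b)) y.
  have -> (s t : tensor g g) : tensor_pairing a b (s - t) =
      tensor_pairing a b s - tensor_pairing a b t.
    by rewrite /tensor_pairing /contract add_lfunE opp_lfunE !pairingE.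
  by rewrite !tensor_pairing_ad !dE; ring.
split=> [[_ _ cocy] x y a b|cocy].
  by rewrite -E -cocy dE.
split=> // [|x y].
  by apply: eq_is_lie_bracket brd_lie => a b; rewrite dual_comultK.
by apply: tensor_pairing_sep => a b; rewrite E -cocy dE.
Qed.

(** * Manin triples and the cocycle condition *)

Lemma bowtie_manin_triple :
  cocycle_identity -> is_manin_triple br brd (bowtie br brd rho mu).
Proof.
move=> /coad_matched_pairP mp; split; first exact: bowtie_lie.
- move=> x y; rewrite /bowtie /= (lie0l brd_lie) !linear0 !zero_lfunE.
  by rewrite !addr0 !subr0.
- move=> a b; rewrite /bowtie /= (lie0l br_lie) !linear0 !zero_lfunE.
  by rewrite !addr0 !subr0.
(* Once the actions are moved across the pairing, the two sides of invariance differ only by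
   antisymmetry of [br] and [brd]. *)
case=> [x a] [y b] [z c]; rewrite /manin_form /bowtie /= !pairingE.
rewrite !coad_bidual_pairing !(coad_pairing br_lie).
rewrite (lieC br_lie y x) (lieC br_lie z x).
rewrite (lieC brd_lie b a) (lieC brd_lie c a) !pairingE.
ring.
Qed.

Lemma manin_formNl (u v : g * dual g) : manin_form (- u) v = - manin_form u v.
Proof. by rewrite /manin_form /= !pairingE opprD. Qed.

Lemma manin_formDl (u v w : g * dual g) :
  manin_form (u + v) w = manin_form u w + manin_form v w.
Proof. by rewrite /manin_form /= !pairingE; ring. Qed.

(** Tested against [(0, a)] or [(y, 0)], invariance regroups the product so that the bracket joins
    two elements of the same summand, where [B] is known. The pairing then separates points. *)
Lemma manin_triple_mixed B : is_manin_triple br brd B ->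
  forall x b, B (x, 0) (0, b) = (- mu b x, rho x b).
Proof.
case=> lB Bl Br inv x b; case E : (B _ _) => [p q].
apply: injective_projections => /=.
  apply: pairing_sep => a.
  have := inv (x, 0) (0, b) (0, a); rewrite E Br /manin_form /=.
  by rewrite !pairingE !addr0 coad_bidual_pairing opprK.
apply: dual_ext => y; rewrite (coad_pairing br_lie).
have := inv (0, b) (x, 0) (y, 0).
rewrite (lieC lB (0, b)) E Bl manin_formNl /manin_form /= !pairingE !add0r => <-.
by rewrite opprK.
Qed.

(** This is the Jacobi identity of [(x, 0)], [(y, 0)], [(0, a)] in Leibniz form, paired with
    [(0, b)]. *)
Lemma manin_triple_cocycle B : is_manin_triple br brd B -> cocycle_identity.
Proof.
move=> mt x y a b; have [lB Bl Br inv] := mt.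
have mixed := manin_triple_mixed mt.
(* Invariance moves the outer bracket with [(s, 0)] onto [(0, b)], leaving the form between two
   mixed brackets. *)
have inv3 s t : manin_form (B (s, 0) (B (t, 0) (0, a))) (0, b) =
    - pairing (brd b (rho t a)) s - pairing (brd a (rho s b)) t.
  rewrite (lieC lB) manin_formNl inv !mixed /manin_form /= !pairingE.
  by rewrite !coad_bidual_pairing; ring.
transitivity (manin_form (B (B (x, 0) (y, 0)) (0, a)) (0, b)).
  by rewrite inv Bl Br /manin_form /= !pairingE addr0.
rewrite (lie_leibniz lB) manin_formDl manin_formNl !inv3.
by rewrite !(lieC brd_lie b) !pairingNl; ring.
Qed.

(** * Endomorphisms and dual representations *)

Lemma dually_represents_bidualP (phi psi : 'End(g)) :
  dually_represents brd (transpose psi) (transpose phi) <->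
  is_endo_rep brd (transpose psi) mu phi.
Proof.
(* Under the identification of the bidual with [g], the double transpose of [phi] becomes [phi] and
   [coad brd] becomes [mu]. *)
have E F a b :
    (pairing (transpose (transpose phi) (coad brd a F)) b =
     pairing (coad brd (transpose psi a) (transpose (transpose phi) F)) b) <->
    (pairing b (phi (mu a (bidual_inv g F))) =
     pairing b (mu (transpose psi a) (phi (bidual_inv g F)))).
  rewrite transposeE !(coad_pairing brd_lie) transposeE.
  rewrite -(transposeE phi) !coad_bidual_pairing.
  by rewrite -(transposeE phi) !bidual_invE.
split=> -[_ H]; split; try exact: coad_bidual_rep; try exact: coad_rep.
  move=> a x; apply: pairing_sep => b; rewrite -(bidualK x).
  by apply/E; rewrite H.
by move=> a F; apply: dual_ext => b; apply/E; rewrite H.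
Qed.

Lemma bowtie_endo (phi psi : 'End(g)) :
    is_lie_endo br phi -> is_lie_endo brd (transpose psi) ->
    is_endo_rep brd (transpose psi) mu phi ->
    is_endo_rep br phi rho (transpose psi) ->
  is_lie_endo (bowtie br brd rho mu) (oplus phi (transpose psi)).
Proof.
move=> phiM psiM [_ muM] [_ rhoM] [x a] [y b]; rewrite !oplusE /bowtie /=.
by rewrite !linearB !linearD /= phiM psiM !muM !rhoM.
Qed.

Lemma manin_triple_endo_rep B (phi psi : 'End(g)) :
    is_manin_triple br brd B -> is_lie_endo B (oplus phi (transpose psi)) ->
  is_endo_rep brd (transpose psi) mu phi /\
  is_endo_rep br phi rho (transpose psi).
Proof.
move=> mt endo.
have E x b : (- phi (mu b x), transpose psi (rho x b)) =
             (- mu (transpose psi b) (phi x), rho (phi x) (transpose psi b)).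
  have := endo (x, 0) (0, b).
  by rewrite !oplusE /= !linear0 !(manin_triple_mixed mt) /= linearN.
split; split.
- exact: coad_bidual_rep.
- by move=> b x; case: (E x b) => /oppr_inj.
- exact: coad_rep.
- by move=> x b; case: (E x b).
Qed.

End Double.

Theorem theorem2p21 (K : fieldType) (g : vectType K)
    (br : g -> g -> g) (brd : dual g -> dual g -> dual g)
    (phi psi : 'End(g))
    (hg : is_endo_lie br phi) (hd : is_endo_lie brd (transpose psi)) :
  let delta := dual_mult brd in
  [<-> is_endo_matched_pair br phi brd (transpose psi)
         (coad br) (coad_bidual brd);
       exists B : g * dual g -> g * dual g -> g * dual g,
         is_endo_manin_triple br phi brd (transpose psi) B;
       is_lie_bialgebra br delta
       /\ dually_represents brd (transpose psi) (transpose phi)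
       /\ dually_represents br phi psi ].
Proof.
move=> delta; have [br_lie phiM] := hg; have [brd_lie psiM] := hd.
tfae.
- case=> _ _ mp mu_rep rho_rep.
  exists (bowtie br brd (coad br) (coad_bidual brd)); split.
    by apply: bowtie_manin_triple => //; apply/coad_matched_pairP.
  exact: bowtie_endo.
- case=> B [mt endo].
  have [mu_rep rho_rep] := manin_triple_endo_rep br_lie brd_lie mt endo.
  split; first exact/lie_bialgebraP/(manin_triple_cocycle _ _ mt).
  (* The condition on [psi] is [rho_rep] by definition; the one on the transpose of [phi] lives on
     the bidual and has to be carried over to [g]. *)
  by split=> //; apply/dually_represents_bidualP.
- case=> /lie_bialgebraP cocy [/dually_represents_bidualP mu_rep rho_rep].
  by split=> //; [apply/coad_matched_pairP; auto | auto].
Qed.
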